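(* Let $(\Omega,\mathcal{F})$ be a standard measurable space, $T:\Omega\to\Omega$ a measurable transformation and $V$ a $T$-invariant upper probability. Let $\{f_n\}_{n\in\mathbb{N}}$ be $\mathcal{F}$-measurable functions such that (i) there exists $\lambda>0$ with $-\lambda n\le f_n(\omega)\le\lambda n$ for all $n\in\mathbb{N}$, $\omega\in\Omega$; (ii) for all $k,n\in\mathbb{N}$, $f_{n+k}\le f_n+f_k\circ T^n$ $V$-a.s. Then there exists a bounded $\mathcal{I}$-measurable function $f^*:\Omega\to\mathbb{R}$ such that $\lim_{n\to\infty}\frac{1}{n}f_n(\omega)=f^*(\omega)$ for $V$-a.s. $\omega\in\Omega$. If, in addition, $V$ is ergodic, then $f^*$ is constant $V$-a.s.
   Context: A measurable space is standard if isomorphic to a complete separable metric space with its Borel $\sigma$-algebra. A capacity is a monotone map $\mu:\mathcal{F}\to[0,1]$ with $\mu(\emptyset)=0,\mu(\Omega)=1$. An upper probability is a capacity $V$ with $V(A)=\max_{P\in\Lambda}P(A)$ for a weak* (setwise convergence) compact set $\Lambda$ of probabilities. $V$ is $T$-invariant if $V(T^{-1}A)=V(A)$. $\mathcal{I}=\{A\in\mathcal{F}:T^{-1}A=A\}$. $V$ is ergodic if for every $B\in\mathcal{I}$, $V(B)\in\{0,1\}$ and ($V(B)=0$ or $V(B^c)=0$). A property holds $V$-a.s. if it holds on a set $A\in\mathcal{F}$ with $V(A^c)=0$. *)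

(* Defs.v *)
From HB Require Import structures.
From mathcomp Require Import all_boot all_order all_algebra.
From mathcomp Require Import all_classical all_reals all_analysis.
Set Implicit Arguments. Unset Strict Implicit. Unset Printing Implicit Defensive.
Import Order.TTheory GRing.Theory Num.Theory.
Local Open Scope classical_set_scope.
Local Open Scope ring_scope.

Definition standard_space {d} {R : realType} (Omega : measurableType d) : Prop :=
  exists (M : completePseudoMetricType R),
    hausdorff_space M /\
    (exists D : set M, countable D /\ dense D) /\
    exists phi : Omega -> M, bijective phi /\
      forall A : set Omega,
        measurable A <-> <<s [set U : set M | open U] >> (phi @` A).

Definition capacity {d} {R : realType} (Omega : measurableType d)
    (V : set Omega -> \bar R) : Prop :=
  [/\ forall A B, measurable A -> measurable B -> A `<=` B -> (V A <= V B)%E,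
      V set0 = 0%E & V setT = 1%E].

(** The vector of values of a probability on measurable sets (0 elsewhere);
    the weak* (setwise convergence) topology on probabilities is the initial
    topology of this map into the pointwise (product) topology. *)
Definition setwise_values {d} {R : realType} (Omega : measurableType d)
    (P : probability Omega R) : {ptws set Omega -> \bar R} :=
  fun A => if `[< measurable A >] then P A else 0%E.

Definition setwise_compact {d} {R : realType} (Omega : measurableType d)
    (L : set (probability Omega R)) : Prop :=
  compact ((@setwise_values d R Omega) @` L).

Definition upper_probability {d} {R : realType} (Omega : measurableType d)
    (V : set Omega -> \bar R) : Prop :=
  capacity V /\
  exists L : set (probability Omega R),
    setwise_compact L /\
    forall A, measurable A ->
      (exists2 P, L P & V A = P A) /\ (forall P, L P -> (P A <= V A)%E).

Definition T_invariant {d} {R : realType} (Omega : measurableType d)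
    (T : Omega -> Omega) (V : set Omega -> \bar R) : Prop :=
  forall A, measurable A -> V (T @^-1` A) = V A.

Definition invariant_set {d} (Omega : measurableType d) (T : Omega -> Omega)
    (A : set Omega) : Prop :=
  measurable A /\ T @^-1` A = A.

Definition ergodic {d} {R : realType} (Omega : measurableType d)
    (T : Omega -> Omega) (V : set Omega -> \bar R) : Prop :=
  forall B, invariant_set T B ->
    (V B = 0%E \/ V B = 1%E) /\ (V B = 0%E \/ V (~` B) = 0%E).

Definition V_as {d} {R : realType} (Omega : measurableType d)
    (V : set Omega -> \bar R) (P : Omega -> Prop) : Prop :=
  exists A : set Omega, [/\ measurable A, V (~` A) = 0%E & A `<=` P].

Definition I_measurable {d} {R : realType} (Omega : measurableType d)
    (T : Omega -> Omega) (f : Omega -> R) : Prop :=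
  forall B : set R, measurable B -> invariant_set T (f @^-1` B).

(* Main.v *)
Require Import Defs.
From HB Require Import structures.
From mathcomp Require Import all_boot all_order all_algebra.
From mathcomp Require Import all_classical all_reals all_analysis.
From mathcomp Require Import measurable_realfun lra.
Import Order.TTheory GRing.Theory Num.Theory.
Import numFieldNormedType.Exports.
Local Open Scope classical_set_scope.
Local Open Scope ring_scope.
Set Implicit Arguments. Unset Strict Implicit. Unset Printing Implicit Defensive.

(** The members of the compact set representing [V] need not be [T]-invariant,
    yet no invariant measure is required. Compactness makes [V] continuous from
    above at the empty set; hence a measurable set that every orbit visits only
    finitely often is [V]-null. Averaging [P (T^-j A) <= V A] along orbits then
    yields a maximal inequality for [V]: the points all of whose iterates
    see [B] with frequency at least [delta] over some initial block form a set
    of upper probability at most [V B / delta].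

    Let [G] be the lower limit of [f_n / n]. By subadditivity it increases along
    almost every orbit, so the sets [{G <= q < limsup_i G (T^i w)}] are visited
    finitely often, and [G] agrees almost surely with the invariant function
    [limsup_i G (T^i w)]. Tiling an orbit by blocks on which [f_m / m] nearly
    attains [G] bounds the upper limit of [f_n / n] by [G], up to the frequency
    of visits to a set of small [V], which the maximal inequality controls. *)

(** * Tiling of orbits by good blocks *)

(** Think of [g i n] as the cost of the block of length [n] starting at time [i], and of [b] as
    marking bad times. Blocks are peeled off from the left: a good time opens a block of length at
    most [N] and rate [c], a bad time a single step of rate [c + K]. The last stretch, of length at
    most [N], is bounded crudely, whence [K * N%:R]. *)
Lemma tiling (R : realType) (g : nat -> nat -> R) (b : nat -> R) (c K : R)
    (N : nat) :
  (0 < N)%N -> 0 <= K -> (forall i, 0 <= b i) ->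
  (forall i n, (0 < n)%N -> g i n <= (c + K) * n%:R) ->
  (forall i m k, (0 < m)%N -> (0 < k)%N ->
     g i (m + k)%N <= g i m + g (i + m)%N k) ->
  (forall i, 1 <= b i \/
     exists m, [/\ (0 < m)%N, (m <= N)%N & g i m <= c * m%:R]) ->
  forall n i, (0 < n)%N ->
    g i n <= c * n%:R + K * \sum_(i <= j < i + n) b j + K * N%:R.
Proof.
move=> N0 K0 b0 gle gsub gtile n.
have sum0 i k : 0 <= \sum_(i <= j < i + k) b j by apply: sumr_ge0 => j _.
elim/ltn_ind: n => n IH i n0.
have [nN|Nn] := leqP n N.
  apply: (le_trans (gle _ _ n0)).
  have : (n%:R : R) <= N%:R by rewrite ler_nat.
  move=> /(ler_wpM2l K0); move: (mulr_ge0 K0 (sum0 i n)); lra.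
(* One block strictly shorter than [n] suffices: subadditivity and the induction hypothesis at time
   [i + m] handle the rest. *)
suff [m [m0 mn gm]] : exists m, [/\ (0 < m)%N, (m < n)%N &
    g i m <= c * m%:R + K * \sum_(i <= j < i + m) b j].
  have k0 : (0 < n - m)%N by rewrite subn_gt0.
  have kn : (n - m < n)%N by rewrite ltn_subrL m0.
  have := gsub i m (n - m)%N m0 k0.
  have := IH _ kn (i + m)%N k0.
  rewrite -addnA subnKC ?(ltnW mn)// natrB ?(ltnW mn)//.
  rewrite (@big_cat_nat _ _ _ (i + m)%N i (i + n)%N) ?leq_addr ?leq_add2l ?(ltnW mn)//=.
  move=> h1 h2; apply: (le_trans h2); apply: (le_trans (lerD gm h1)).
  by rewrite mulrDr; lra.
have [bi|[m [m0 mN gm]]] := gtile i; last first.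
  exists m; split => //; first exact: leq_ltn_trans Nn.
  apply: (le_trans gm); rewrite lerDl; exact: mulr_ge0.
exists 1%N; split => //; first exact: leq_ltn_trans N0 Nn.
apply: (le_trans (gle _ _ _)) => //.
by rewrite addn1 big_nat1 mulr1; move: (ler_wpM2l K0 bi); lra.
Qed.

(** * Upper limits of bounded real sequences *)

(** Since [fine] sends infinite values to 0, this is the upper limit only when the latter is finite,
    in particular for bounded sequences. *)
Definition limsup {R : realType} (u : nat -> R) : R :=
  fine (limn_esup (EFin \o u)).

Lemma EFin_limsup (R : realType) (u : nat -> R) (M : R) :
  (forall n, `|u n| <= M) -> (limsup u)%:E = limn_esup (EFin \o u).
Proof.
move=> uM; rewrite fineK// fin_numE; apply/andP; split.
- apply/eqP => eqy; have : (limn_esup (EFin \o u) < (- M - 1)%:E)%E.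
    by rewrite eqy ltNyr.
  move=> /ereal_inf_lt[_ [A [N _ NA] <-]].
  apply/negP; rewrite -leNgt; apply: le_trans (ereal_sup_ubound _); last first.
    by exists N => //; apply: NA => /=.
  by rewrite lee_fin; have := uM N; rewrite ler_norml => /andP[? _]; lra.
- rewrite -ltey; apply: (@le_lt_trans _ _ M%:E); last exact: ltey.
  apply: (@le_trans _ _ (ereal_sup ((EFin \o u) @` setT))).
    by apply: ereal_inf_lbound; exists setT => //; exact: filterT.
  apply: ge_ereal_sup => _ [n _ <-]; rewrite lee_fin.
  exact: le_trans (ler_norm _) (uM n).
Qed.

Lemma limsup_lt (R : realType) (u : nat -> R) (M y : R) :
  (forall n, `|u n| <= M) -> limsup u < y ->
  exists N, forall n, (N <= n)%N -> u n < y.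
Proof.
move=> uM; rewrite -lte_fin (EFin_limsup uM) => /ereal_inf_lt[_ [A [N _ NA] <-]].
move=> supy; exists N => n Nn; rewrite -lte_fin; apply: le_lt_trans supy.
by apply: ereal_sup_ubound; exists n => //; apply: NA.
Qed.

Lemma lt_limsup (R : realType) (u : nat -> R) (M y : R) :
  (forall n, `|u n| <= M) -> y < limsup u ->
  forall N, exists2 n, (N <= n)%N & y < u n.
Proof.
move=> uM ylt N; apply: contrapT => noN.
move: ylt; apply/negP; rewrite -leNgt -lee_fin (EFin_limsup uM).
apply: (@le_trans _ _ (ereal_sup ((EFin \o u) @` [set n | (N <= n)%N]))).
  by apply: ereal_inf_lbound; eexists; [exact: nbhs_infty_ge|].
apply: ge_ereal_sup => _ [n /= Nn <-]; rewrite lee_fin leNgt.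
by apply/negP => yu; apply: noN; exists n.
Qed.

(** The index [m] may differ from [n], which allows comparison with shifted sequences. *)
Lemma limsup_le (R : realType) (u v : nat -> R) (M : R) :
  (forall n, `|u n| <= M) -> (forall n, `|v n| <= M) ->
  (forall e N, 0 < e -> exists N', forall n, (N' <= n)%N ->
     exists2 m, (N <= m)%N & u n <= v m + e) ->
  limsup u <= limsup v.
Proof.
move=> uM vM uv; rewrite leNgt; apply/negP => vu.
(* With a third of the gap, [u n] exceeds [limsup v + 2 * e] infinitely often, while [v m + e] is
   eventually below it. *)
pose e := (limsup u - limsup v) / 3.
have e0 : 0 < e by rewrite /e; lra.
have [N vN] := @limsup_lt _ v M (limsup v + e) vM ltac:(lra).
have [N' uvN] := uv e N e0.
have [n] := @lt_limsup _ u M (limsup v + 2 * e) uM ltac:(rewrite /e; lra) N'.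
move=> N'n un; have [m Nm um] := uvN _ N'n; have := vN m Nm.
lra.
Qed.

Lemma limsup_norm (R : realType) (u : nat -> R) (M : R) :
  (forall n, `|u n| <= M) -> `|limsup u| <= M.
Proof.
move=> uM; rewrite ler_norml; apply/andP; split; rewrite leNgt; apply/negP => h.
- have [N /(_ N (leqnn N))] := limsup_lt uM h.
  by have := uM N; rewrite ler_norml => /andP[? _]; lra.
- have [n _] := lt_limsup uM h 0%N.
  by have := uM n; rewrite ler_norml => /andP[_ ?]; lra.
Qed.

Lemma limsup_shift (R : realType) (u : nat -> R) (M : R) :
  (forall n, `|u n| <= M) -> limsup (fun n => u n.+1) = limsup u.
Proof.
move=> uM; apply/eqP; rewrite eq_le; apply/andP; split.
- apply: (limsup_le (M := M)) => // e N e0; exists N => n Nn.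
  by exists n.+1; [exact: ltnW|lra].
- apply: (limsup_le (M := M)) => // e N e0; exists N.+1 => -[//|n] Nn.
  by exists n => //; lra.
Qed.

(** Applying [T] only shifts the sequence. The equality holds at every point, so the limit function
    built below is invariant everywhere and not just almost surely. *)
Lemma limsup_orbit (R : realType) (Omega : Type) (T : Omega -> Omega)
    (g : Omega -> R) (M : R) n w :
  (forall w, `|g w| <= M) ->
  limsup (fun i => g (iter i T (iter n T w))) = limsup (fun i => g (iter i T w)).
Proof.
move=> gM; elim: n => [//|n <-] /=.
rewrite -(limsup_shift (u := fun i => g (iter i T (iter n T w))) (fun=> gM _)).
by congr limsup; apply/funext => i; rewrite -iterSr.
Qed.

Lemma measurable_limsup d (Omega : measurableType d) (R : realType)
    (u : nat -> Omega -> R) :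
  (forall n, measurable_fun setT (u n)) ->
  measurable_fun setT (fun w => limsup (u ^~ w)).
Proof.
move=> mu.
rewrite (_ : (fun w => _) = fine \o (fun w => limn_esup (fun n => (u n w)%:E)))//.
apply: measurableT_comp; first exact: fine_measurable.
apply: (measurable_fun_limn_esup (f := fun n w => (u n w)%:E)) => n.
exact/measurable_EFinP.
Qed.

(** * Continuity at the empty set and null sets of an upper probability *)

(* Dini-type argument: along a cluster point [P] of maximizers [P_ n] of the
   [A n], every [P (A n)] would stay at least [e]. *)
Lemma upper_probability_cvg0 d (R : realType) (Omega : measurableType d)
    (V : set Omega -> \bar R) (A : nat -> set Omega) (e : R) :
  upper_probability V -> (forall n, measurable (A n)) -> nonincreasing_seq A ->
  \bigcap_n A n = set0 -> 0 < e -> exists n, (V (A n) < e%:E)%E.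
Proof.
move=> [_ [L [cL VL]]] mA dA A0 e0; apply: contrapT => noV.
have eV n : (e%:E <= V (A n))%E.
  by rewrite leNgt; apply/negP => h; apply: noV; exists n.
have /choice[P_ P_P] n : exists P, L P /\ V (A n) = P (A n).
  by have [[P LP VP] _] := VL _ (mA n); exists P.
pose F := (fun n => setwise_values (P_ n)) @ \oo.
have [_ [[P LP <-] clP]] : @setwise_values d R Omega @` L `&` cluster F !=set0.
  by apply: cL; exists 0%N => // n _ /=; exists (P_ n) => //; exact: (P_P n).1.
have eP n : (e%:E <= P (A n))%E.
  rewrite leNgt; apply/negP => Plt.
  (* For [k >= n], [A k] lies in [A n], so [P_ k (A n) >= P_ k (A k) = V (A k) >= e]. *)
  have FA : F [set v | (e%:E <= v (A n))%E].
    exists n => // k /= nk; rewrite /setwise_values asboolT//.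
    apply: (le_trans (eV k)); rewrite (P_P k).2; apply: le_measure; rewrite ?inE//.
    exact/subsetPset/dA.
  have nP : nbhs (setwise_values P) [set v | (v (A n) < e%:E)%E].
    apply: (@proj_continuous _ _ (A n) (setwise_values P) [set x | (x < e%:E)%E]).
    apply: open_nbhs_nbhs; split; first exact: open_ereal_lt_ereal.
    by rewrite /= /setwise_values /proj asboolT.
  have [v [/= h1 h2]] := clP _ _ FA nP.
  by move: (le_lt_trans h1 h2); rewrite ltxx.
have Pfin : (P (A 0%N) < +oo)%E.
  by apply: (le_lt_trans (probability_le1 _ _)) => //; exact: ltey.
have mcap : measurable (\bigcap_n A n) by rewrite A0.
have := nonincreasing_cvg_mu Pfin mA mcap dA.
rewrite A0 measure0 => cv.
have : (e%:E <= 0)%E by apply: (cvge_ge _ cv); near=> k; exact: eP.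
by rewrite lee_fin leNgt e0.
Unshelve. all: by end_near. Qed.

Lemma upper_probability_ge0 d (R : realType) (Omega : measurableType d)
    (V : set Omega -> \bar R) (A : set Omega) :
  upper_probability V -> measurable A -> (0 <= V A)%E.
Proof. by move=> [_ [L [_ VL]]] /VL[[P _ ->] _]; exact: measure_ge0. Qed.

(** The value at the union is attained by one countably additive [P], and [P <= V] makes every [A n]
    null for [P]. *)
Lemma upper_probability_bigcup0 d (R : realType) (Omega : measurableType d)
    (V : set Omega -> \bar R) (A : nat -> set Omega) :
  upper_probability V -> (forall n, measurable (A n)) ->
  (forall n, V (A n) = 0%E) -> V (\bigcup_n A n) = 0%E.
Proof.
move=> [_ [L [_ VL]]] mA VA.
have mU : measurable (\bigcup_n A n) by exact: bigcupT_measurable.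
have [[P LP ->] _] := VL _ mU.
apply/(negligibleP P mU); apply: negligible_bigcup => k.
apply/(negligibleP P (mA k)); apply/eqP; rewrite eq_le measure_ge0 andbT.
by rewrite -(VA k); have [_] := VL _ (mA k); exact.
Qed.

Lemma upper_probability_null_sub d (R : realType) (Omega : measurableType d)
    (V : set Omega -> \bar R) (A B : set Omega) :
  upper_probability V -> measurable A -> measurable B -> A `<=` B ->
  V B = 0%E -> V A = 0%E.
Proof.
move=> UV mA mB AB VB; apply/eqP; rewrite eq_le upper_probability_ge0// andbT.
by rewrite -VB; case: UV => -[mono _ _] _; exact: mono.
Qed.

Lemma V_as_sub d (R : realType) (Omega : measurableType d)
    (V : set Omega -> \bar R) (P Q : Omega -> Prop) :
  (forall w, P w -> Q w) -> V_as V P -> V_as V Q.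
Proof. by move=> PQ [A [mA VA AP]]; exists A; split => // w /AP/PQ. Qed.

Lemma V_as_forall d (R : realType) (Omega : measurableType d)
    (V : set Omega -> \bar R) (P : nat -> Omega -> Prop) :
  upper_probability V -> (forall n, V_as V (P n)) ->
  V_as V (fun w => forall n, P n w).
Proof.
move=> UV /choice[A AP]; exists (\bigcap_n A n); split.
- by apply: bigcapT_measurable => n; have [] := AP n.
- rewrite setC_bigcap; apply: upper_probability_bigcup0 => // n.
    by apply: measurableC; have [] := AP n.
  by have [] := AP n.
- by move=> w Aw n; have [_ _] := AP n; apply; apply: Aw.
Qed.

Lemma V_as_and d (R : realType) (Omega : measurableType d)
    (V : set Omega -> \bar R) (P Q : Omega -> Prop) :
  upper_probability V -> V_as V P -> V_as V Q -> V_as V (fun w => P w /\ Q w).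
Proof.
move=> UV VP VQ; have := @V_as_forall _ _ _ _ (fun n => if n is 0%N then P else Q) UV.
move=> /(_ _)/V_as_sub; apply; last by case.
by move=> w h; split; [exact: (h 0%N)|exact: (h 1%N)].
Qed.

(** * Orbits and wandering sets *)

Lemma measurable_iter d (Omega : measurableType d) (T : Omega -> Omega) n :
  measurable_fun setT T -> measurable_fun setT (iter n T).
Proof.
move=> mT; elim: n => [|n IH]; first exact: measurable_id.
exact: (measurableT_comp mT IH).
Qed.

Lemma measurable_preimage_iter d (Omega : measurableType d) (T : Omega -> Omega)
    n (A : set Omega) :
  measurable_fun setT T -> measurable A -> measurable (iter n T @^-1` A).
Proof.
by move=> mT mA; rewrite -[X in measurable X]setTI; apply: measurable_iter.
Qed.

Lemma T_invariant_iter d (R : realType) (Omega : measurableType d)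
    (T : Omega -> Omega) (V : set Omega -> \bar R) n (A : set Omega) :
  measurable_fun setT T -> T_invariant T V -> measurable A ->
  V (iter n T @^-1` A) = V A.
Proof.
move=> mT TV mA; elim: n => [//|n <-].
rewrite -(TV _ (measurable_preimage_iter n mT mA)).
by congr V; apply/seteqP; split => w /=; rewrite -iterSr.
Qed.

Lemma V_as_orbit d (R : realType) (Omega : measurableType d)
    (T : Omega -> Omega) (V : set Omega -> \bar R) (P : Omega -> Prop) :
  measurable_fun setT T -> upper_probability V -> T_invariant T V ->
  V_as V P -> V_as V (fun w => forall i, P (iter i T w)).
Proof.
move=> mT UV TV [A [mA VA AP]]; apply: V_as_forall => // i.
exists (iter i T @^-1` A); split => [||w /= /AP//].
  exact: measurable_preimage_iter.
by rewrite preimage_setC T_invariant_iter//; exact: measurableC.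
Qed.

(** The sets [U n] of points that visit [A] at some time [j >= n] decrease to the empty set, so
    [V (U n)] becomes small, whereas [V A = V (T^-n A) <= V (U n)] by invariance. *)
Lemma upper_probability_wandering d (R : realType) (Omega : measurableType d)
    (T : Omega -> Omega) (V : set Omega -> \bar R) (A : set Omega) :
  measurable_fun setT T -> upper_probability V -> T_invariant T V ->
  measurable A ->
  (forall w, exists n, forall j, (n <= j)%N -> ~ A (iter j T w)) ->
  V A = 0%E.
Proof.
move=> mT UV TV mA wand.
pose U n := \bigcup_(j in [set j | (n <= j)%N]) (iter j T @^-1` A).
have mU n : measurable (U n).
  by apply: bigcup_measurable => j _; exact: measurable_preimage_iter.
have dU : nonincreasing_seq U.
  move=> m n mn; apply/subsetPset => w [j /= nj Aj].
  by exists j => //=; exact: leq_trans nj.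
have U0 : \bigcap_n U n = set0.
  rewrite -subset0 => w Uw; have [n An] := wand w.
  by have [j /= /An] := Uw n I.
apply/eqP; rewrite eq_le upper_probability_ge0// andbT.
apply/lee_addgt0Pr => e e0; rewrite add0e.
have [n Vn] := upper_probability_cvg0 UV mU dU U0 e0.
apply: le_trans (ltW Vn); rewrite -(T_invariant_iter n mT TV mA).
case: UV => -[mono _ _] _; apply: mono => //.
  exact: measurable_preimage_iter.
by move=> w Aw; exists n => /=.
Qed.

(** * Visit frequencies and the maximal inequality *)

Lemma natmul_bounded_le0 (R : realType) (x y : R) :
  (forall n, (0 < n)%N -> n%:R * x <= y) -> x <= 0.
Proof.
move=> xy; rewrite leNgt; apply/negP => x0.
have /archi_boundP : 0 <= `|y| / x by rewrite divr_ge0// ltW.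
set n := Num.bound _; rewrite ltr_pdivrMr// => yn.
have n0 : (0 < n)%N.
  rewrite lt0n; apply: contraTneq yn => ->.
  by rewrite mul0r -leNgt.
by have := xy _ n0; have := ler_norm y; lra.
Qed.

Lemma measurable_set_le d (Omega : measurableType d) (R : realType)
    (g h : Omega -> R) :
  measurable_fun setT g -> measurable_fun setT h ->
  measurable [set w | g w <= h w].
Proof.
move=> mg mh; rewrite -[X in measurable X]setTI.
exact: (measurable_fun_ler mg mh measurableT (Y := [set true])).
Qed.

Lemma measurable_set_lt d (Omega : measurableType d) (R : realType)
    (g h : Omega -> R) :
  measurable_fun setT g -> measurable_fun setT h ->
  measurable [set w | g w < h w].
Proof.
move=> mg mh; rewrite -[X in measurable X]setTI.
exact: (measurable_fun_ltr mg mh measurableT (Y := [set true])).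
Qed.

Definition visits {d} {R : realType} {Omega : measurableType d}
    (T : Omega -> Omega) (B : set Omega) (n : nat) (w : Omega) : R :=
  \sum_(0 <= j < n) \1_B (iter j T w).

Lemma visits_ge0 d (R : realType) (Omega : measurableType d)
    (T : Omega -> Omega) (B : set Omega) n w : (0 : R) <= visits T B n w.
Proof. by apply: sumr_ge0 => j _; rewrite indicE. Qed.

Lemma visitsD d (R : realType) (Omega : measurableType d)
    (T : Omega -> Omega) (B : set Omega) m n w :
  visits T B (m + n) w = visits T B m w + visits T B n (iter m T w) :> R.
Proof.
rewrite /visits (@big_cat_nat _ _ _ m) ?leq_addr//=; congr (_ + _).
rewrite -{1}[m]add0n [(m + n)%N]addnC big_addn addnK.
by apply: eq_bigr => j _; rewrite -iterD.
Qed.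

Lemma visits_le d (R : realType) (Omega : measurableType d)
    (T : Omega -> Omega) (B : set Omega) n w : visits T B n w <= n%:R :> R.
Proof.
rewrite /visits; apply: (@le_trans _ _ (\sum_(0 <= j < n) 1)).
  by apply: ler_sum => j _; rewrite indicE lern1 leq_b1.
by rewrite sumr_const_nat subn0.
Qed.

Lemma measurable_visits d (R : realType) (Omega : measurableType d)
    (T : Omega -> Omega) (B : set Omega) n :
  measurable_fun setT T -> measurable B ->
  measurable_fun setT (visits T B n : Omega -> R).
Proof.
move=> mT mB; apply: measurable_sum => j.
exact: (measurableT_comp (measurable_indic mB) (measurable_iter j mT)).
Qed.

(** [P] itself may fail to be invariant; each term obeys [P (T^-j B) <= V (T^-j B) = V B]. *)
Lemma integral_visits_le d (R : realType) (Omega : measurableType d)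
    (T : Omega -> Omega) (V : set Omega -> \bar R) (P : probability Omega R)
    (B : set Omega) n :
  measurable_fun setT T -> T_invariant T V -> measurable B ->
  (forall A, measurable A -> (P A <= V A)%E) ->
  (\int[P]_w (visits T B n w)%:E <= n%:R%:E * V B)%E.
Proof.
move=> mT TV mB PV.
under eq_integral do rewrite /visits -sumEFin.
rewrite ge0_integral_sum//; last first.
  move=> j; apply/measurable_EFinP.
  exact: (measurableT_comp (measurable_indic mB) (measurable_iter j mT)).
have -> : (n%:R%:E * V B = \sum_(0 <= j < n) V B)%E.
  by rewrite mule_natl sumr_const_nat subn0.
apply: lee_sum => j _; rewrite -(T_invariant_iter j mT TV mB).
have mj := measurable_preimage_iter j mT mB.
by rewrite (integral_indic P measurableT mj) setIT; exact: PV.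
Qed.

(** Requiring the condition at every iterate makes the set forward invariant, as tiling demands; a
    point outside it has an iterate from which all visit frequencies stay below [delta]. *)
Definition frequent_set {d} {R : realType} {Omega : measurableType d}
    (T : Omega -> Omega) (B : set Omega) (delta : R) : set Omega :=
  [set w | forall i, exists2 m, (0 < m)%N &
     delta * m%:R <= visits T B m (iter i T w)].

Lemma measurable_frequent_set d (R : realType) (Omega : measurableType d)
    (T : Omega -> Omega) (B : set Omega) (delta : R) :
  measurable_fun setT T -> measurable B -> measurable (frequent_set T B delta).
Proof.
move=> mT mB.
rewrite (_ : frequent_set _ _ _ = \bigcap_i (iter i T @^-1`
    \bigcup_(m in [set m | (0 < m)%N])
      [set w | delta * m%:R <= visits T B m w])).
  apply: bigcapT_measurable => i; apply: measurable_preimage_iter => //.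
  apply: bigcup_measurable => m _; apply: measurable_set_le => //.
  exact: measurable_visits.
apply/seteqP; split=> w.
  by move=> Dw i _; have [m m0 mle] := Dw i; exists m.
by move=> Dw i; have [m m0 mle] := Dw i I; exists m.
Qed.

Lemma frequent_set_iter d (R : realType) (Omega : measurableType d)
    (T : Omega -> Omega) (B : set Omega) (delta : R) i w :
  frequent_set T B delta w -> frequent_set T B delta (iter i T w).
Proof. by move=> Dw j; rewrite -iterD; exact: Dw. Qed.

(** From some time [i] on, every block has frequency below [delta]; the first [i] steps contribute
    at most [i] visits. *)
Lemma visits_not_frequent d (R : realType) (Omega : measurableType d)
    (T : Omega -> Omega) (B : set Omega) (delta : R) w :
  0 <= delta -> ~ frequent_set T B delta w ->
  exists i, forall n, visits T B n w <= i%:R + delta * n%:R.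
Proof.
move=> d0 /existsNP[i noi]; exists i => n.
have [ni|/ltnW ni] := leqP n i.
  apply: (le_trans (visits_le _ _ _ _ _)).
  have : (n%:R : R) <= i%:R by rewrite ler_nat.
  have : 0 <= delta * n%:R by rewrite mulr_ge0.
  lra.
rewrite -(subnKC ni) visitsD.
apply: lerD; first exact: visits_le.
have [->|k0] := posnP (n - i)%N.
  by rewrite /visits big_geq// mulr_ge0.
apply: (@le_trans _ _ (delta * (n - i)%:R)).
  rewrite leNgt; apply/negP => h; apply: noi; exists (n - i)%N => //.
  exact: ltW.
by apply: ler_wpM2l => //; rewrite ler_nat leq_addl.
Qed.

Lemma upper_probability_fin_num d (R : realType) (Omega : measurableType d)
    (V : set Omega -> \bar R) (A : set Omega) :
  upper_probability V -> measurable A -> V A \is a fin_num.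
Proof.
by move=> [_ [L [_ VL]]] mA; have [[P _ ->] _] := VL _ mA; exact: fin_num_measure.
Qed.

(* The orbits of points of [D := frequent_set T B delta] are tiled by blocks of
   length at most [M + 1] in which [B] has frequency at least [delta], up to the
   visits to the small set [C M]. *)
Lemma frequent_set_tiling d (R : realType) (Omega : measurableType d)
    (T : Omega -> Omega) (B : set Omega) (delta : R) (M n : nat) w :
  let D := frequent_set T B delta in
  let C := D `&` \bigcap_(m in [set m | (0 < m <= M.+1)%N])
                    [set w | visits T B m w < delta * m%:R] in
  0 < delta -> (0 < n)%N ->
  delta * n%:R * \1_D w <=
    visits T B n w + (delta * visits T C n w + delta * M.+1%:R).
Proof.
move=> D C d0 n0; rewrite indicE; case: (boolP (w \in D)) => [|_]; last first.
  by rewrite mulr0 !addr_ge0// ?visits_ge0// mulr_ge0// ?visits_ge0// ltW.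
rewrite inE mulr1 => Dw.
(* Negated visit counts turn frequency at least [delta] into rate at most [c = - delta]. With
   [K = delta] the crude rate [c + K] is 0, which holds because visits are nonnegative. *)
pose g i m : R := - visits T B m (iter i T w).
have := @tiling R g (fun j => \1_C (iter j T w)) (- delta) delta M.+1 isT (ltW d0).
have h1 i : 0 <= \1_C (iter i T w) :> R by rewrite indicE.
have h2 i m : (0 < m)%N -> g i m <= (- delta + delta) * m%:R.
  by rewrite addNr mul0r oppr_le0 visits_ge0.
have h3 i m k : (0 < m)%N -> (0 < k)%N -> g i (m + k)%N <= g i m + g (i + m)%N k.
  by rewrite /g visitsD opprD -iterD [(m + i)%N]addnC.
have h4 i : 1 <= \1_C (iter i T w) :> R \/
    exists m, [/\ (0 < m)%N, (m <= M.+1)%N & g i m <= - delta * m%:R].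
  have [Ci|nCi] := pselect (C (iter i T w)).
    by left; rewrite indicE mem_set.
  right; apply: contrapT => nom; apply: nCi; split; first exact: frequent_set_iter.
  move=> m /= /andP[m0 mM]; rewrite ltNge; apply/negP => le; apply: nom.
  by exists m; split => //; rewrite /g mulNr lerN2.
move=> /(_ h1 h2 h3 h4 n 0%N n0); rewrite /g add0n /= -/(visits T C n w).
lra.
Qed.

(** Let [P] attain [V] at [D]. Integrating [frequent_set_tiling] against [P] and dividing by [n]
    bounds [delta * V D] by [V B + delta * V (C M)] plus a term of order [1 / n]; [V (C M)] is small
    for large [M]. *)
Lemma maximal_inequality d (R : realType) (Omega : measurableType d)
    (T : Omega -> Omega) (V : set Omega -> \bar R) (B : set Omega) (delta : R) :
  measurable_fun setT T -> upper_probability V -> T_invariant T V ->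
  measurable B -> 0 < delta ->
  (delta%:E * V (frequent_set T B delta) <= V B)%E.
Proof.
move=> mT UV TV mB d0; set D := frequent_set T B delta.
have mD : measurable D by exact: measurable_frequent_set.
(* Points of [D] with no initial block of length at most [M.+1] of frequency at least [delta]. The
   definition of [D] at [i = 0] shows that no point stays in all of them. *)
pose C M := D `&` \bigcap_(m in [set m | (0 < m <= M.+1)%N])
                    [set w | visits T B m w < delta * m%:R].
have mC M : measurable (C M).
  apply: measurableI => //; apply: bigcap_measurable => [|m _]; first by exists 1%N.
  by apply: measurable_set_lt => //; exact: measurable_visits.
have dC : nonincreasing_seq C.
  move=> m n mn; apply/subsetPset => w [Dw Cw]; split => // k /= /andP[k0 km].
  by apply: Cw; rewrite /= k0 (leq_trans km).
have C0 : \bigcap_n C n = set0.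
  rewrite -subset0 => w Cw; have [Dw _] := Cw 0%N I.
  have [m m0 le] := Dw 0%N; have [_ /(_ m)] := Cw m I.
  by rewrite /= m0 leqnSn => /(_ isT); rewrite ltNge le.
apply/lee_addgt0Pr => e e0.
(* [M] is fixed before [n], with [delta * V (C M) < e]. *)
have [M VM] := upper_probability_cvg0 UV mC dC C0 (divr_gt0 e0 d0).
have finV A : measurable A -> V A \is a fin_num by exact: upper_probability_fin_num.
have [_ [L [_ VL]]] := UV.
have [[P LP VDP] _] := VL _ mD.
have PV A : measurable A -> (P A <= V A)%E by move=> mA; exact: (VL _ mA).2.
have key n : (0 < n)%N ->
    ((delta * n%:R)%:E * V D <= n%:R%:E * V B +
      (delta%:E * (n%:R%:E * V (C M)) + (delta * M.+1%:R)%:E))%E.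
  move=> n0.
  have mvB := measurable_visits (R := R) n mT mB.
  have mvC := measurable_visits (R := R) n mT (mC M).
  have vB0 w : (0 <= (visits T B n w : R)%:E)%E by rewrite lee_fin visits_ge0.
  have vC0 w : (0 <= (visits T (C M) n w : R)%:E)%E by rewrite lee_fin visits_ge0.
  have dM0 : 0 <= delta * M.+1%:R by rewrite mulr_ge0// ltW.
  have -> : ((delta * n%:R)%:E * V D =
             \int[P]_w (delta * n%:R * \1_D w)%:E)%E.
    under eq_integral do rewrite EFinM.
    rewrite ge0_integralZl//; last 2 first.
    - by apply/measurable_EFinP; exact: measurable_indic.
    - by rewrite lee_fin mulr_ge0// ltW.
    by rewrite integral_indic// setIT VDP.
  apply: (@le_trans _ _ (\int[P]_w ((visits T B n w)%:E +
      (delta%:E * (visits T (C M) n w)%:E + (delta * M.+1%:R)%:E)))%E).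
    apply: ge0_le_integral => //.
    - by move=> w _; rewrite lee_fin !mulr_ge0// ?indicE// ltW.
    - by apply/measurable_EFinP; exact: measurable_funM.
    - apply/measurable_EFinP; apply: measurable_funD => //.
      by apply: measurable_funD => //; apply: measurable_funM.
    - by move=> w _; rewrite -EFinM -!EFinD lee_fin frequent_set_tiling.
  have mB' : measurable_fun setT (fun w => (visits T B n w : R)%:E).
    exact/measurable_EFinP.
  have mC' : measurable_fun setT (fun w => (visits T (C M) n w : R)%:E).
    exact/measurable_EFinP.
  have dvC0 w : (0 <= delta%:E * (visits T (C M) n w : R)%:E)%E.
    by rewrite mule_ge0// lee_fin ltW.
  have mdC : measurable_fun setT (fun w => delta%:E * (visits T (C M) n w : R)%:E)%E.
    exact: measurable_funeM.
  have mdCM : measurable_fun setT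
      (fun w => delta%:E * (visits T (C M) n w : R)%:E + (delta * M.+1%:R)%:E)%E.
    exact: emeasurable_funD.
  rewrite ge0_integralD// => [|w _]; last by rewrite adde_ge0// lee_fin.
  apply: leeD; first exact: (integral_visits_le _ mT TV).
  have intM : (\int[P]_w (delta * M.+1%:R)%:E = (delta * M.+1%:R)%:E)%E.
    rewrite integral_cst// -[RHS]mule1; congr (_ * _)%E.
    exact: probability_setT.
  rewrite ge0_integralD// intM leeD2r//.
  rewrite ge0_integralZl//; last by rewrite lee_fin ltW.
  apply: lee_wpmul2l; first by rewrite lee_fin ltW.
  exact: (integral_visits_le _ mT TV).
move: key VM; rewrite -(fineK (finV _ mD)) -(fineK (finV _ mB)) -(fineK (finV _ (mC M))).
set p := fine _; set b := fine _; set c := fine _ => key.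
rewrite lte_fin ltr_pdivlMr// => ce.
rewrite -EFinM -EFinD lee_fin -subr_le0.
(* Letting [n] grow removes the boundary term [delta * M.+1%:R], which does not depend on [n]. *)
apply: (@natmul_bounded_le0 _ _ (delta * M.+1%:R)) => n n0.
have := key n n0; rewrite -!EFinM -!EFinD lee_fin.
have : n%:R * (c * delta) <= n%:R * e by rewrite ler_wpM2l// ltW.
nra.
Qed.

(** * Lower limits of averages *)

Definition liminf {R : realType} (u : nat -> R) : R :=
  - limsup (fun n => - u n).

Lemma lt_liminf (R : realType) (u : nat -> R) (M y : R) :
  (forall n, `|u n| <= M) -> y < liminf u ->
  exists N, forall n, (N <= n)%N -> y < u n.
Proof.
move=> uM; rewrite /liminf ltrNr => h.
have uM' n : `|- u n| <= M by rewrite normrN.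
have [N uN] := limsup_lt uM' h.
by exists N => n /uN; rewrite ltrN2.
Qed.

Lemma liminf_lt (R : realType) (u : nat -> R) (M y : R) :
  (forall n, `|u n| <= M) -> liminf u < y ->
  forall N, exists2 n, (N <= n)%N & u n < y.
Proof.
move=> uM; rewrite /liminf ltrNl => h N.
have uM' n : `|- u n| <= M by rewrite normrN.
have [n Nn un] := lt_limsup uM' h N.
by exists n => //; move: un; rewrite ltrN2.
Qed.

Lemma liminf_norm (R : realType) (u : nat -> R) (M : R) :
  (forall n, `|u n| <= M) -> `|liminf u| <= M.
Proof. by move=> uM; rewrite normrN; apply: limsup_norm => n; rewrite normrN. Qed.

Lemma nat_ge_mul (R : realType) (e x : R) :
  0 < e -> exists N, forall n, (N <= n)%N -> x <= e * n%:R.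
Proof.
move=> e0; have /archi_boundP : 0 <= `|x| / e by rewrite divr_ge0// ltW.
set N := Num.bound _; rewrite ltr_pdivrMr// => xN; exists N => n Nn.
apply: (le_trans (ler_norm x)); apply: (le_trans (ltW xN)).
by rewrite mulrC ler_wpM2l ?ler_nat// ltW.
Qed.

Lemma norm_div_nat_le (R : realType) (u : nat -> R) (lam : R) :
  0 <= lam -> (forall n, (0 < n)%N -> `|u n| <= lam * n%:R) ->
  forall n, `|u n / n%:R| <= lam.
Proof.
(* Division by zero yields 0, so the term at [n = 0] is harmless whatever [u 0] is. *)
move=> lam0 ulam [|n]; first by rewrite invr0 mulr0 normr0.
rewrite normrM normfV [`|n.+1%:R|]ger0_norm// ler_pdivrMr ?ltr0n//.
exact: ulam.
Qed.

(** Applied to [f] along the orbits of [w] and [T w], this makes the lower limit increase along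
    orbits. *)
Lemma liminf_div_nat_le (R : realType) (u v : nat -> R) (lam : R) :
  0 <= lam -> (forall n, (0 < n)%N -> `|u n| <= lam * n%:R) ->
  (forall n, (0 < n)%N -> `|v n| <= lam * n%:R) ->
  (forall n, (0 < n)%N -> u n.+1 <= u 1%N + v n) ->
  liminf (fun n => u n / n%:R) <= liminf (fun n => v n / n%:R).
Proof.
move=> lam0 ulam vlam uv; rewrite lerN2.
have au := norm_div_nat_le lam0 ulam; have av := norm_div_nat_le lam0 vlam.
apply: (limsup_le (M := lam)) => [n|n|e N e0]; rewrite ?normrN//.
(* Changing the denominator from [n] to [n.+1] leaves the error [u 1 - v n / n], at most [2 * lam],
   to be absorbed by [e * n.+1%:R]. *)
have [N' N'le] := nat_ge_mul (2 * lam) e0.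
exists (maxn 1 (maxn N N')) => n; rewrite !geq_max => /and3P[n0 Nn N'n].
exists n.+1; first exact: leqW.
suff : u n.+1 / n.+1%:R <= v n / n%:R + e.
  by set x := u n.+1 / _; set y := v n / _; lra.
rewrite ler_pdivrMr ?ltr0n//; apply: (le_trans (uv n n0)).
have n0' : (n%:R : R) != 0 by rewrite pnatr_eq0 -lt0n.
have h1 := N'le n N'n; have := av n; rewrite ler_norml => /andP[h2 _].
have := ulam 1%N isT; rewrite mulr1 ler_norml => /andP[_ h3].
rewrite -[n.+1%:R]natr1 mulrDr mulr1 mulrDl divfK//.
by move: h1 h2 h3; set y := v n / _; set z := e * _; lra.
Qed.

(** * Functions that increase along orbits *)

Lemma V_as_measurable d (R : realType) (Omega : measurableType d)
    (V : set Omega -> \bar R) (A : set Omega) :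
  upper_probability V -> measurable A -> V_as V A -> V (~` A) = 0%E.
Proof.
move=> UV mA [B [mB VB BA]].
apply: (upper_probability_null_sub UV _ _ _ VB); try exact: measurableC.
exact: subsetC.
Qed.

Lemma V_as_notin d (R : realType) (Omega : measurableType d)
    (V : set Omega -> \bar R) (A : set Omega) :
  measurable A -> V A = 0%E -> V_as V (fun w => ~ A w).
Proof.
by move=> mA VA; exists (~` A); split => //; [exact: measurableC|rewrite setCK].
Qed.

(** Rational thresholds indexed by [nat], so that [V_as_forall] applies; codes of no rational give
    0. *)
Definition ratr_enum {R : realType} (n : nat) : R :=
  if unpickle n is Some r then ratr (r : rat) else 0.

Lemma ratr_enum_between (R : realType) (x y : R) :
  x < y -> exists n, x < ratr_enum n < y.
Proof.
move=> /rat_in_itvoo[r]; rewrite in_itv /= => rxy.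
by exists (pickle r); rewrite /ratr_enum pickleK.
Qed.

(* Points of [{G <= q < limsup_i G (T^i w)}] leave it for good, since [G]
   increases along orbits. *)
Lemma orbit_monotone_invariant d (R : realType) (Omega : measurableType d)
    (T : Omega -> Omega) (V : set Omega -> \bar R) (E : set Omega)
    (G : Omega -> R) (M : R) :
  measurable_fun setT T -> upper_probability V -> T_invariant T V ->
  measurable E -> V (~` E) = 0%E -> measurable_fun setT G ->
  (forall w, `|G w| <= M) ->
  (forall w i, E w -> E (iter i T w)) ->
  (forall w i, E w -> G w <= G (iter i T w)) ->
  V_as V (fun w => limsup (fun i => G (iter i T w)) <= G w).
Proof.
move=> mT UV TV mE VE mG GM EE Gmono.
pose Gs w := limsup (fun i => G (iter i T w)).
have mGs : measurable_fun setT Gs.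
  by apply: measurable_limsup => i; exact: (measurableT_comp mG (measurable_iter i mT)).
have Gs_iter w i : Gs (iter i T w) = Gs w := limsup_orbit T i w GM.
pose A q := E `&` ([set w | G w <= q] `&` [set w | q < Gs w]).
have mA q : measurable (A q).
  apply: measurableI => //; apply: measurableI.
    exact: measurable_set_le.
  exact: measurable_set_lt.
have VA q : V (A q) = 0%E.
  apply: (upper_probability_wandering mT UV TV) => // w.
  (* In the first case [G] exceeds [q] at some later time [j] and stays above it; in the second the
     orbit never meets [A q], because [Gs] is constant along it. *)
  have [[i [Ei qG]]|noi] := pselect (exists i, E (iter i T w) /\ q < Gs w).
    have [j ij qj] := lt_limsup (u := fun i => G (iter i T w)) (fun n => GM _) qG i.
    exists j => l jl [_ [/= Gl _]].
    have Ej : E (iter j T w) by rewrite -(subnK ij) iterD; exact: EE.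
    have := Gmono _ (l - j)%N Ej; rewrite -iterD subnK//; lra.
  exists 0%N => j _ [Ej [_ /=]]; rewrite Gs_iter => qG.
  by apply: noi; exists j.
have := V_as_forall UV (fun n => V_as_notin (mA (ratr_enum n)) (VA _)).
have asE : V_as V E by exists E; split.
move=> asA; apply: V_as_sub (V_as_and UV asE asA) => w [Ew nA].
rewrite leNgt; apply/negP => /ratr_enum_between[n /andP[n1 n2]].
by apply: (nA n); split => //; split => //=; exact: ltW.
Qed.

(** * Linear upper bound for subadditive sequences *)

(** [B N] collects the points of [E] with no good block of length at most [N.+1], and [V (B N)]
    tends to 0. By the maximal inequality almost no point visits every [B N] with frequency at least
    [delta]; for the others, tiling charges the visits to a suitable [B N] at rate [2 * lam]. *)
Lemma subadditive_upper_bound d (R : realType) (Omega : measurableType d)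
    (T : Omega -> Omega) (V : set Omega -> \bar R) (E : set Omega)
    (f : nat -> Omega -> R) (c : Omega -> R) (lam delta : R) :
  measurable_fun setT T -> upper_probability V -> T_invariant T V ->
  measurable E -> V (~` E) = 0%E -> (forall w i, E w -> E (iter i T w)) ->
  (forall n, measurable_fun setT (f n)) -> measurable_fun setT c ->
  (forall w i, c (iter i T w) = c w) ->
  0 < lam -> (forall w, `|c w| <= lam) ->
  (forall n w, (0 < n)%N -> f n w <= lam * n%:R) ->
  (forall w m k, E w -> (0 < m)%N -> (0 < k)%N ->
     f (m + k)%N w <= f m w + f k (iter m T w)) ->
  0 < delta ->
  (forall w, E w -> exists2 n, (0 < n)%N & f n w <= (c w + delta) * n%:R) ->
  V_as V (fun w => exists C, forall n, (0 < n)%N ->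
    f n w <= (c w + (1 + 2 * lam) * delta) * n%:R + C).
Proof.
move=> mT UV TV mE VE EE mf mc cT lam0 clam flam fsub d0 fc.
pose B N := E `&` \bigcap_(m in [set m | (0 < m <= N.+1)%N])
                    [set w | (c w + delta) * m%:R < f m w].
have mB N : measurable (B N).
  apply: measurableI => //; apply: bigcap_measurable => [|m _]; first by exists 1%N.
  apply: measurable_set_lt => //; apply: measurable_funM => //.
  exact: measurable_funD.
have dB : nonincreasing_seq B.
  move=> m n mn; apply/subsetPset => w [Ew Bw]; split => // k /= /andP[k0 km].
  by apply: Bw; rewrite /= k0 (leq_trans km).
have B0 : \bigcap_n B n = set0.
  rewrite -subset0 => w Bw; have [Ew _] := Bw 0%N I.
  have [m m0 le] := fc w Ew; have [_ /(_ m)] := Bw m I.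
  by rewrite /= m0 leqnSn => /(_ isT); rewrite ltNge le.
pose D N := frequent_set T (B N) delta.
have mD N : measurable (D N) by exact: measurable_frequent_set.
have mcapD : measurable (\bigcap_N D N) by exact: bigcapT_measurable.
have VD : V (\bigcap_N D N) = 0%E.
  apply/eqP; rewrite eq_le upper_probability_ge0// andbT.
  apply/lee_addgt0Pr => e e0; rewrite add0e.
  have [N VN] := upper_probability_cvg0 UV mB dB B0 (mulr_gt0 d0 e0).
  apply: (@le_trans _ _ (V (D N))).
    by case: (UV) => -[mono _ _] _; apply: mono => // w; exact.
  have := le_lt_trans (maximal_inequality mT UV TV (mB N) d0) VN.
  by rewrite EFinM lte_pmul2l ?lte_fin// => /ltW.
have asE : V_as V E by exists E; split.
apply: V_as_sub (V_as_and UV asE (V_as_notin mcapD VD)) => w [Ew].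
move=> /existsNP[N /not_implyP[_ nDN]].
have [i vi] := visits_not_frequent (ltW d0) nDN.
(* The first term pays for the visits not covered by the frequency bound, the second for the last
   stretch of the tiling. *)
exists (2 * lam * i%:R + 2 * lam * N.+1%:R) => n n0.
have K0 : 0 <= 2 * lam by rewrite mulr_ge0// ltW.
(* [K = 2 * lam] works since [c w >= - lam] gives [lam <= c w + delta + 2 * lam]. *)
have := @tiling R (fun i m => f m (iter i T w)) (fun j => \1_(B N) (iter j T w))
  (c w + delta) (2 * lam) N.+1 isT K0.
have h1 j : 0 <= \1_(B N) (iter j T w) :> R by rewrite indicE.
have h2 j m : (0 < m)%N -> f m (iter j T w) <= (c w + delta + 2 * lam) * m%:R.
  move=> m0; apply: (le_trans (flam _ _ m0)); apply: ler_wpM2r => //.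
  by have := clam w; rewrite ler_norml => /andP[? ?]; lra.
have h3 j m k : (0 < m)%N -> (0 < k)%N ->
    f (m + k)%N (iter j T w) <= f m (iter j T w) + f k (iter (j + m) T w).
  by move=> m0 k0; rewrite [(j + m)%N]addnC iterD; apply: fsub => //; exact: EE.
have h4 j : 1 <= \1_(B N) (iter j T w) :> R \/ exists m,
    [/\ (0 < m)%N, (m <= N.+1)%N & f m (iter j T w) <= (c w + delta) * m%:R].
  have [Bj|nBj] := pselect (B N (iter j T w)).
    by left; rewrite indicE mem_set.
  right; apply: contrapT => nom; apply: nBj; split; first exact: EE.
  move=> m /= /andP[m0 mN]; rewrite ltNge; apply/negP => le; apply: nom.
  by exists m; split => //; move: le; rewrite cT.
move=> /(_ h1 h2 h3 h4 n 0%N n0) /=; rewrite add0n -/(visits T (B N) n w) => h.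
apply: (le_trans h).
have := ler_wpM2l K0 (vi n); rewrite mulrDr; lra.
Qed.

(** * Invariant functions in the ergodic case *)

(** The constant is the supremum of the levels [x] for which [{g < x}] is null; countably many
    levels on either side pin [g] down. *)
Lemma invariant_ergodic_cst d (R : realType) (Omega : measurableType d)
    (T : Omega -> Omega) (V : set Omega -> \bar R) (g : Omega -> R) (M : R) :
  upper_probability V -> I_measurable T g -> (forall w, `|g w| <= M) ->
  ergodic T V -> exists c, V_as V (fun w => g w = c).
Proof.
move=> UV Ig gM erg.
have mg : measurable_fun setT g.
  by move=> _ Y mY; rewrite setTI; have [] := Ig Y mY.
pose lo x := [set w | g w < x].
have mlo x : measurable (lo x) by exact: measurable_set_lt.
have Ilo x : invariant_set T (lo x).
  have -> : lo x = g @^-1` `]-oo, x[%classic.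
    by apply/seteqP; split => w /=; rewrite in_itv.
  by apply: Ig; exact: measurable_itv.
pose S := [set x | V (lo x) = 0%E].
have S0 : S (- M).
  rewrite /S /= (_ : lo _ = set0); first by case: UV => -[].
  rewrite -subset0 => w; rewrite /lo /=.
  by have := gM w; rewrite ler_norml => /andP[? _]; rewrite ltNge => /negP; exact.
have Sub : ubound S (M + 1).
  move=> x Sx; rewrite leNgt; apply/negP => Mx; move: Sx.
  rewrite /S /= (_ : lo x = setT); first by case: UV => -[_ _ ->] _ /eqP; rewrite onee_eq0.
  rewrite -subTset => w _; rewrite /lo /=.
  by have := gM w; rewrite ler_norml => /andP[_ ?]; lra.
have hS : has_sup S by split; [exists (- M)|exists (M + 1)].
pose c := sup S.
have Vlt x : x < c -> V (lo x) = 0%E.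
  move=> xc; have [y Sy xy] := sup_adherent (eps := c - x) ltac:(lra) hS.
  apply: (upper_probability_null_sub UV (mlo x) (mlo y) _ Sy) => w.
  by rewrite /lo /= => gx; rewrite -/c in xy; lra.
(* As [V] need not be additive, [V (lo x) = 1] would not suffice; the second clause of ergodicity
   makes the complement null. *)
have Vgt x : c < x -> V (~` lo x) = 0%E.
  move=> cx; have [_ [Vx|//]] := erg _ (Ilo x).
  by have := ub_le_sup (proj2 hS) (Vx : S x); rewrite leNgt cx.
exists c.
have as1 : V_as V (fun w => forall n, c - n.+1%:R^-1 <= g w).
  apply: V_as_forall => // n.
  have cn : c - n.+1%:R^-1 < c by rewrite ltrBlDr ltrDl invr_gt0.
  by apply: V_as_sub (V_as_notin (mlo _) (Vlt _ cn)) => w /negP; rewrite -leNgt.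
have as2 : V_as V (fun w => forall n, g w <= c + n.+1%:R^-1).
  apply: V_as_forall => // n.
  have cn : c < c + n.+1%:R^-1 by rewrite ltrDl invr_gt0.
  apply: V_as_sub (V_as_notin (measurableC (mlo _)) (Vgt _ cn)) => w /contrapT.
  exact: ltW.
apply: V_as_sub (V_as_and UV as1 as2) => w [ge le].
have inv0 (x : R) : (forall n : nat, x <= n.+1%:R^-1) -> x <= 0.
  move=> xn; apply: (@natmul_bounded_le0 _ _ 1) => -[//|n] _.
  by rewrite -ler_pdivlMl ?ltr0n// mulr1.
apply/eqP; rewrite eq_le -subr_le0 -[c <= _]subr_le0.
by apply/andP; split; apply: inv0 => n; rewrite lerBlDl// -lerBlDr.
Qed.

(** * Convergence of the averages *)

Theorem theorem7p1 (d : measure_display) (R : realType)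
    (Omega : measurableType d) (T : Omega -> Omega) (V : set Omega -> \bar R)
    (f : nat -> Omega -> R) :
  standard_space (R := R) Omega ->
  measurable_fun setT T ->
  upper_probability V ->
  T_invariant T V ->
  (forall n, measurable_fun setT (f n)) ->
  (exists2 lam : R, 0 < lam &
     forall n w, (0 < n)%N -> - (lam * n%:R) <= f n w <= lam * n%:R) ->
  (forall k n, (0 < k)%N -> (0 < n)%N ->
     V_as V (fun w => f (n + k)%N w <= f n w + f k (iter n T w))) ->
  exists fstar : Omega -> R,
    [/\ I_measurable T fstar,
        (exists M : R, forall w, `|fstar w| <= M),
        V_as V (fun w => (fun n => f n w / n%:R) @ \oo --> fstar w)
      & ergodic T V -> exists c : R, V_as V (fun w => fstar w = c)].
Proof.
move=> _ mT UV TV mf [lam lam0 flam] fsub.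
have fnorm w n : (0 < n)%N -> `|f n w| <= lam * n%:R.
  by move=> n0; rewrite ler_norml flam.
have anorm w n : `|f n w / n%:R| <= lam.
  by move: n; apply: norm_div_nat_le; [exact: ltW|exact: fnorm].
pose G w := liminf (fun n => f n w / n%:R).
have mG : measurable_fun setT G.
  apply: measurable_funN; apply: measurable_limsup => n.
  by apply: measurable_funN; apply: measurable_funM.
have Gnorm w : `|G w| <= lam by exact: liminf_norm.
pose Gs w := limsup (fun i => G (iter i T w)).
have mGs : measurable_fun setT Gs.
  by apply: measurable_limsup => i; exact: (measurableT_comp mG (measurable_iter i mT)).
have Gsnorm w : `|Gs w| <= lam by exact: limsup_norm.
have Gs_iter w i : Gs (iter i T w) = Gs w := limsup_orbit T i w Gnorm.
have IGs : I_measurable T Gs.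
  move=> Y mY; split; first by rewrite -[X in measurable X]setTI; exact: mGs.
  by apply/seteqP; split => w /=; rewrite (Gs_iter w 1%N).
pose sub n k := [set w | f (n.+1 + k.+1)%N w <= f n.+1 w + f k.+1 (iter n.+1 T w)].
(* Subadditivity is imposed along the whole orbit, which makes [E1] forward invariant. *)
pose E1 := \bigcap_i (iter i T @^-1` \bigcap_n \bigcap_k sub n k).
have mE1 : measurable E1.
  apply: bigcapT_measurable => i; apply: measurable_preimage_iter => //.
  apply: bigcapT_measurable => n; apply: bigcapT_measurable => k.
  apply: measurable_set_le => //; apply: measurable_funD => //.
  exact: (measurableT_comp (mf _) (measurable_iter n.+1 mT)).
have asE1 : V_as V E1.
  have := V_as_orbit mT UV TV (V_as_forall UV (fun n => V_as_forall UV
    (fun k => fsub k.+1 n.+1 isT isT))).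
  by apply: V_as_sub => w Ew i _ n _ k _; exact: Ew.
have E1sub w i m k : E1 w -> (0 < m)%N -> (0 < k)%N ->
    f (m + k)%N (iter i T w) <= f m (iter i T w) + f k (iter m T (iter i T w)).
  by case: m k => [//|m] [//|k] Ew _ _; exact: (Ew i I m I k I).
have E1iter w i : E1 w -> E1 (iter i T w).
  by move=> Ew j _ n _ k _; rewrite /preimage /= -iterD; exact: (Ew (j + i)%N I n I k I).
have Gmono w i : E1 w -> G w <= G (iter i T w).
  move=> Ew; elim: i => [//|i IH]; apply: (le_trans IH).
  apply: liminf_div_nat_le (ltW lam0) (fnorm _) (fnorm _) _ => n n0.
  exact: (E1sub w i 1%N n Ew).
have asG := orbit_monotone_invariant mT UV TV mE1 (V_as_measurable UV mE1 asE1)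
  mG Gnorm E1iter Gmono.
(* On [E2] the lower limit [G] coincides with the invariant [Gs]; the other inequality is [GGs]. *)
pose E2 := E1 `&` [set w | Gs w <= G w].
have mE2 : measurable E2 by apply: measurableI => //; exact: measurable_set_le.
have asE2 : V_as V E2 by exact: V_as_and.
have VE2 := V_as_measurable UV mE2 asE2.
have E2iter w i : E2 w -> E2 (iter i T w).
  move=> [Ew /= Gw]; split; first exact: E1iter.
  by rewrite /= Gs_iter (le_trans Gw)// Gmono.
have GGs w : E1 w -> G w <= Gs w.
  move=> Ew; rewrite leNgt; apply/negP => h.
  have [N /(_ N (leqnn N))] := limsup_lt (u := fun i => G (iter i T w))
    (fun n => Gnorm _) h.
  by have := Gmono w N Ew; lra.
have asU : V_as V (fun w => forall k, exists C, forall n, (0 < n)%N ->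
    f n w <= (Gs w + (1 + 2 * lam) * k.+1%:R^-1) * n%:R + C).
  apply: V_as_forall => // k.
  apply: (subadditive_upper_bound mT UV TV mE2 VE2) => //.
  - by move=> n w n0; have /andP[] := flam n w n0.
  - by move=> w m j [Ew _]; exact: (E1sub w 0%N).
  - move=> w [Ew _].
    have h : G w < Gs w + k.+1%:R^-1.
      by apply: le_lt_trans (GGs w Ew) _; rewrite ltrDl invr_gt0.
    (* The bound [1%N] on the index excludes the meaningless average at [n = 0]. *)
    have [n n0 lt] := liminf_lt (anorm w) h 1%N.
    by exists n => //; move: lt; rewrite ltr_pdivrMr ?ltr0n// => /ltW.
exists Gs; split => //; [by exists lam| |exact: invariant_ergodic_cst].
apply: V_as_sub (V_as_and UV asE2 asU) => w [[Ew /= GsG] ub].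
apply/cvgrPdist_le => e e0.
have [N1 lo] := @lt_liminf _ _ _ (Gs w - e) (anorm w) ltac:(rewrite -/(G w); lra).
(* Half of [e] absorbs the slope error [(1 + 2 * lam) / k0.+1], the other half the constant [C]
   divided by [n]. *)
have [k0 hk] := nat_ge_mul (1 + 2 * lam) (divr_gt0 e0 (ltr0Sn R 1)).
have [C hC] := ub k0.
have [N2 hi] := nat_ge_mul C (divr_gt0 e0 (ltr0Sn R 1)).
exists (maxn 1 (maxn N1 N2)) => // n; rewrite /= !geq_max => /and3P[n0 N1n N2n].
rewrite ler_norml; apply/andP; split; last by have := lo n N1n; lra.
suff : f n w / n%:R <= Gs w + e by set x := f n w / _; lra.
rewrite ler_pdivrMr ?ltr0n//; apply: (le_trans (hC n n0)).
have ek : (1 + 2 * lam) * k0.+1%:R^-1 <= e / 2.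
  by rewrite ler_pdivrMr ?ltr0n//; apply: hk.
move: ek; set x := _ * _^-1 => /(ler_wpM2r (ler0n R n)).
by have := hi n N2n; lra.
Qed.
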